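(* Let $V$ be a finite set, $d:V^2\to[0,\infty)$ a distance function, and $P:\mathbb{R}^V\to\mathbb{R}^V$ a nonlinear Markov chain satisfying (1) monotonicity: $u\ge v$ implies $Pu\ge Pv$; (2) strict monotonicity of corresponding components: $u\ge v$ and $u(x)>v(x)$ for some $x\in V$ imply $Pu(x)>Pv(x)$; (4) constant additivity: $P(u+C\cdot\overrightarrow{1})=Pu+C\cdot\overrightarrow{1}$ for all $C\in\mathbb{R}$; for all $u,v\in\mathbb{R}^V$. Let $r>0$, assume $Ric_r(P,d)\ge0$, and let $x_0\in V$. Then for all $f\in\mathbb{R}^V$ with $Lip(f)\le r$ there exists $g\in\mathbb{R}^V$ such that, as $n\to\infty$, $$P^nf-P^nf(x_0)\cdot\overrightarrow{1}\to g\qquad\text{and}\qquad P^nf-P^{n-1}f\to c\cdot\overrightarrow{1}\ \text{ for some constant }c\in\mathbb{R}.$$ In particular, $Pg=g+c\cdot\overrightarrow{1}$.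
   Context: Inequalities between functions are pointwise; $\overrightarrow{1}$ is the constant function $1$ on $V$; $P^n$ is the $n$-fold iterate of $P$. $Lip(f)=\sup_{x\ne y\in V}\frac{|f(x)-f(y)|}{d(x,y)}$. For $r>0$, the Ollivier Ricci curvature of the nonlinear Markov chain is $Ric_r(P,d)=1-\sup_{Lip(f)\le r}\frac{Lip(Pf)}{r}$. *)

(* Defs.v *)
From HB Require Import structures.
From mathcomp Require Import all_boot all_order all_algebra.
From mathcomp Require Import all_classical all_reals all_analysis.
Set Implicit Arguments.
Unset Strict Implicit.
Unset Printing Implicit Defensive.
Import Order.TTheory GRing.Theory Num.Theory.
Import numFieldNormedType.Exports.
Local Open Scope classical_set_scope.
Local Open Scope ring_scope.

Definition is_distance (R : realType) (V : finType) (d : V -> V -> R) : Prop :=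
  [/\ forall x y, 0 <= d x y,
      forall x y, d x y = 0 <-> x = y,
      forall x y, d x y = d y x &
      forall x y z, d x z <= d x y + d y z].

(* The pointwise order [u >= v] on functions. *)
Definition pw_ge (R : realType) (V : finType) (u v : V -> R) : Prop :=
  forall x, v x <= u x.

Definition monotone_op (R : realType) (V : finType)
    (P : (V -> R) -> (V -> R)) : Prop :=
  forall u v, pw_ge u v -> pw_ge (P u) (P v).

Definition strictly_monotone_op (R : realType) (V : finType)
    (P : (V -> R) -> (V -> R)) : Prop :=
  forall u v x, pw_ge u v -> v x < u x -> P v x < P u x.

Definition constant_additive (R : realType) (V : finType)
    (P : (V -> R) -> (V -> R)) : Prop :=
  forall u (C : R), P (u \+ cst C) = P u \+ cst C.

(* [V] being finite, the supremum is finite; when [V] has a single point, it is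
   taken over the empty set and [Lip d f = 0] since [sup set0 = 0]. *)
Definition Lip (R : realType) (V : finType) (d : V -> V -> R) (f : V -> R) : R :=
  sup [set `|f p.1 - f p.2| / d p.1 p.2 | p in [set p : V * V | p.1 != p.2]].

(* The supremum is taken in the extended reals because it may be infinite for
   an arbitrary [P]; the real [sup] would then take the junk value 0. *)
Definition Ric (R : realType) (V : finType) (r : R)
    (P : (V -> R) -> (V -> R)) (d : V -> V -> R) : \bar R :=
  (1 - ereal_sup [set (Lip d (P f) / r)%:E | f in [set f | Lip d f <= r]%R])%E.

(* Main.v *)
(* Monotonicity and constant additivity make P nonexpansive for the sup norm,
   and nonnegative curvature keeps every P^n f in the set Lip <= r, so the
   normalized orbit P^n f - P^n f(x0) is bounded and has a cluster point g.
   The number max (P^(n+1) f - P^n f) decreases to a limit c, whence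
   max (P^(j+1) g - P^j g) = c for every j. By strict monotonicity the sets of
   maximizers decrease with j, so P^j g x = g x + j c for all j at some x.
   Likewise the minimal growth rate is realized along the orbit at some y;
   boundedness of P^j g x - P^j g y makes the two rates equal, i.e. P g = g + c.
   Nonexpansiveness then upgrades the cluster point to a limit. *)

Require Import Defs.
From HB Require Import structures.
From mathcomp Require Import all_boot all_order all_algebra.
From mathcomp Require Import all_classical all_reals all_analysis.
From mathcomp Require Import lra.
Set Implicit Arguments.
Unset Strict Implicit.
Unset Printing Implicit Defensive.
Import Order.TTheory GRing.Theory Num.Theory.
Import numFieldNormedType.Exports.
Local Open Scope classical_set_scope.
Local Open Scope ring_scope.

(** * Compactness, Lipschitz bounds and maxima over a finite set *)

Section FiniteDomain.
Context {R : realType} {V : finType}.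
Implicit Types (d : V -> V -> R) (f g h u v : V -> R) (a c e : R) (x y : V).

(* pointwise_cvgP wants a topology on the domain; any one will do. *)
Lemma ptws_cvgP (u_ : nat -> V -> R) g :
  {ptws, u_ @ \oo --> g} <-> forall x, (fun n => u_ n x) @ \oo --> g x.
Proof.
exact: (@pointwise_cvgP (discrete_topology V) R (u_ @ \oo) g).
Qed.

(** The cube [[- K, K]] to the power [V] is compact by Tychonoff; since [V] is finite, a uniform
    ball around [g] is a pointwise neighbourhood of [g]. *)
Lemma bounded_cluster (v_ : nat -> V -> R) (K : R) :
  (forall n x, `|v_ n x| <= K) ->
  exists g, forall e, 0 < e -> forall N, exists2 n, (N <= n)%N &
    forall x, `|v_ n x - g x| < e.
Proof.
move=> vK.
have coK : @compact (prod_topology (fun _ : V => R : topologicalType))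
    [set f | forall x, `[- K, K]%classic (f x)].
  exact: (@tychonoff V (fun=> R : topologicalType) (fun=> `[- K, K]%classic)
    (fun=> @segment_compact R (- K) K)).
have v_in : (v_ @ \oo) [set f | forall x, `[- K, K]%classic (f x)].
  by exists 0%N => // n _ x /=; rewrite in_itv /= -ler_norml.
have [g [_ clg]] := coK (v_ @ \oo) _ v_in.
exists g => e e0 N.
have near_g : @nbhs _ (prod_topology (fun _ : V => R : topologicalType)) g
    [set f | forall x, `|f x - g x| < e].
  apply: (@filter_forall _ V (fun x (f : prod_topology _) => `|f x - g x| < e)
    (nbhs (g : {ptws V -> R})) (nbhs_filter _)) => x.
  have gx : (fun f : {ptws V -> R} => f x) @ (g : {ptws V -> R}) --> g x.
    exact: (@proj_continuous V (fun=> R : topologicalType) x g).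
  exact: cvgr_distC_lt.
have far : (v_ @ \oo) [set v_ n | n in [set n | (N <= n)%N]].
  by exists N => // n /= Nn; exists n.
by have [_ [[n Nn <-] ve]] := clg _ _ far near_g; exists n.
Qed.

Lemma Lip_le_dist d f r x y :
  is_distance d -> Lip d f <= r -> `|f x - f y| <= r * d x y.
Proof.
move=> [d_ge0 d_eq0 _ _] Lf.
have [->|xy] := eqVneq x y.
  by rewrite subrr normr0 (d_eq0 y y).2// mulr0.
have d_gt0 : 0 < d x y.
  rewrite lt_neqAle d_ge0 andbT eq_sym; apply/eqP => /d_eq0 /eqP.
  exact/negP.
rewrite -ler_pdivrMr//; apply: le_trans Lf; apply: ub_le_sup.
  (* The sum of all quotients bounds each of them, so [sup] does not take its default value. *)
  exists (\sum_(p : V * V) `|f p.1 - f p.2| / d p.1 p.2) => _ [p _ <-].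
  rewrite (bigD1 p)//= lerDl sumr_ge0// => q _.
  by rewrite divr_ge0.
by exists (x, y).
Qed.

Lemma Ric_ge0_Lip d (P : (V -> R) -> V -> R) r f : 0 < r ->
  (0 <= Ric r P d)%E -> Lip d f <= r -> Lip d (P f) <= r.
Proof.
move=> r0; rewrite /Ric sube_ge0 ?orbT// => S1 Lf.
have : ((Lip d (P f) / r)%:E <= 1)%E.
  by apply: le_trans S1; apply: ereal_sup_ubound; exists f.
by rewrite lee_fin ler_pdivrMr// mul1r.
Qed.

(** Starting from [h x0] keeps the result among the values of [h]. *)
Definition fmax x0 h : R := \big[Num.max/h x0]_x h x.

Lemma fmax_ge x0 h x : h x <= fmax x0 h.
Proof. exact: le_bigmax. Qed.

Lemma fmax_le x0 h c : (forall x, h x <= c) -> fmax x0 h <= c.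
Proof. by move=> hc; apply: bigmax_le. Qed.

Lemma fmax_eq x0 h : exists x, fmax x0 h = h x.
Proof.
rewrite /fmax; elim/big_ind : _ => [|_ _ [x ->] [y ->]|x _]; first by exists x0.
- by rewrite /Num.max; case: ifP => _; [exists y|exists x].
- by exists x.
Qed.

End FiniteDomain.

(** * Iterates of monotone, constant-additive operators *)

Section Translation.
Context {R : realType} {V : finType} (P : (V -> R) -> V -> R).
Hypotheses (P_mono : monotone_op P) (P_const : constant_additive P).
Implicit Types (f g u v : V -> R) (a c e : R) (x y : V) (n m : nat).

Lemma op_le_shift u v c :
  (forall x, u x <= v x + c) -> forall x, P u x <= P v x + c.
Proof.
by move=> uv x; have := P_mono (u := v \+ cst c) uv x; rewrite P_const.
Qed.

Lemma iter_le_shift n u v c : (forall x, u x <= v x + c) ->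
  forall x, iter n P u x <= iter n P v x + c.
Proof. by move=> uv; elim: n => // n IH; exact: op_le_shift. Qed.

(** Nonexpansiveness around an offset [a]: the orbit of [f] approaches that of [g] only up to
    additive constants. *)
Lemma iter_dist_shift n u v a e : (forall x, `|u x - v x - a| <= e) ->
  forall x, `|iter n P u x - iter n P v x - a| <= e.
Proof.
move=> uv x.
have h1 : iter n P u x <= iter n P v x + (a + e).
  by apply: iter_le_shift => y; have := uv y; rewrite ler_norml; lra.
have h2 : iter n P v x <= iter n P u x + (e - a).
  by apply: iter_le_shift => y; have := uv y; rewrite ler_norml; lra.
by rewrite ler_norml; lra.
Qed.

Lemma iter_eigen g c n : P g = g \+ cst c ->
  forall x, iter n P g x = g x + c *+ n.
Proof.
move=> Pg; suff -> : iter n P g = g \+ cst (c *+ n) by [].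
elim: n => [|n /= ->]; first by apply/funext => x /=; rewrite mulr0n addr0.
by rewrite P_const Pg; apply/funext => x /=; rewrite -addrA mulrS.
Qed.

(** By strict monotonicity, a point that grows by less than [c] at one step does so at all later
    steps. The sets of points growing by exactly [c] thus decrease; being nonempty subsets of a
    finite set, they share a point. *)
Lemma persistent_growth g c : strictly_monotone_op P ->
  (forall x, P g x <= g x + c) ->
  (forall n, exists x, iter n.+1 P g x = iter n P g x + c) ->
  exists x, forall n, iter n P g x = g x + c *+ n.
Proof.
move=> P_strict Pg ex.
have le n x : iter n.+1 P g x <= iter n P g x + c.
  by rewrite iterSr; exact: iter_le_shift.
have desc x n m : (n <= m)%N -> iter m.+1 P g x = iter m P g x + c ->
    iter n.+1 P g x = iter n P g x + c.
  move=> /subnK <-; elim: (m - n)%N => // k IH Hk; apply: IH.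
  apply/eqP; rewrite eq_le le /= leNgt; apply/negP => lt.
  have := P_strict (iter (k + n) P g \+ cst c) (iter (k + n).+1 P g) x
    (fun y => le _ y) lt.
  by rewrite P_const -iterS [X in X < _]Hk ltxx.
have [x Hx] : exists x, forall n, iter n.+1 P g x = iter n P g x + c.
  apply: contrapT => /forallNP no.
  have /choice[N HN] : forall x, exists n, iter n.+1 P g x <> iter n P g x + c.
    by move=> x; apply/existsNP.
  (* By the time [\max_x N x] every point would have failed. *)
  have [x Hx] := ex (\max_x N x)%N.
  by apply: (HN x); apply: desc Hx; exact: leq_bigmax.
exists x; elim=> [|n IH]; first by rewrite mulr0n addr0.
by rewrite Hx IH mulrSr addrA.
Qed.

End Translation.

(** * Cluster points of the normalized orbit *)

Definition normalized (R : realType) (V : finType) (x0 : V) (u : V -> R) :=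
  u \- cst (u x0).

Definition orbit_cluster (R : realType) (V : finType) (x0 : V)
    (P : (V -> R) -> V -> R) (f g : V -> R) :=
  forall e : R, 0 < e -> forall N, exists2 n, (N <= n)%N &
    forall x, `|normalized x0 (iter n P f) x - g x| < e.

Section Cluster.
Context {R : realType} {V : finType} (x0 : V).
Implicit Types (P : (V -> R) -> V -> R) (f g u v : V -> R) (a c e : R) (x y : V).

Lemma orbit_cluster_iter P f g : monotone_op P -> constant_additive P ->
  orbit_cluster x0 P f g -> forall e, 0 < e -> forall N, exists2 n, (N <= n)%N &
  exists a, forall j x, `|iter (j + n) P f x - iter j P g x - a| <= e.
Proof.
move=> P_mono P_const cl e e0 N; have [n Nn ng] := cl e e0 N.
(* The offset is the constant removed by the normalization at time [n]. *)
exists n => //; exists (iter n P f x0) => j.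
rewrite iterD; apply: iter_dist_shift => // x.
by have := ng x; rewrite /normalized/= addrAC => /ltW.
Qed.

Lemma cluster_max_growth P f g : monotone_op P -> strictly_monotone_op P ->
  constant_additive P -> orbit_cluster x0 P f g ->
  exists c, (forall x, P g x <= g x + c) /\
    exists x, forall n, iter n P g x = g x + c *+ n.
Proof.
move=> P_mono P_strict P_const /(orbit_cluster_iter P_mono P_const) cl.
pose D n := fmax x0 (iter n.+1 P f \- iter n P f).
have Dx n x : iter n.+1 P f x <= iter n P f x + D n.
  by have := fmax_ge x0 (iter n.+1 P f \- iter n P f) x; rewrite /D /=; lra.
have Dmono n j : D (j + n)%N <= D n.
  apply: fmax_le => x /=; rewrite -iterS -addnS !iterD lerBlDl.
  by apply: (iter_le_shift P_mono P_const) => y; exact: Dx.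
have [b Db] : exists b, forall n, b <= D n.
  (* Iterating [f <= P f + max (f - P f)] bounds the growth at [x0] from below at every time. *)
  exists (- fmax x0 (f \- P f)) => n.
  have := Dx n x0.
  have : iter n P f x0 <= iter n P (P f) x0 + fmax x0 (f \- P f).
    apply: (iter_le_shift P_mono P_const) => y.
    by have := fmax_ge x0 (f \- P f) y; rewrite /=; lra.
  by rewrite -iterSr; lra.
have hasinf : has_inf (range D).
  by split; [exists (D 0%N), 0%N|exists b => _ [n _ <-]].
pose c := inf (range D).
have cD n : c <= D n by apply: ge_inf; [exact: hasinf.2|exists n].
have growth j : fmax x0 (iter j.+1 P g \- iter j P g) = c.
  apply/eqP; rewrite eq_le; apply/andP; split; apply/ler_addgt0Pl => e e0.
  (* One third for [D N] against its infimum, two for the approximations at times [j] and [j.+1];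
     the offset [a] cancels in the difference. *)
  - have e3 : 0 < e / 3 by lra.
    have [_ [N _ <-] DN] := inf_adherent e3 hasinf.
    have [n Nn [a ng]] := cl _ e3 N.
    have DnN : D (j + n)%N <= D N.
      by rewrite -(subnK Nn) addnA Dmono.
    apply: fmax_le => x /=.
    have := ng j x; have := ng j.+1 x; have := Dx (j + n)%N x.
    by rewrite addSn /c !ler_norml/=; lra.
  - have e2 : 0 < e / 2 by lra.
    have [n _ [a ng]] := cl _ e2 0%N.
    apply: (le_trans (cD (j + n)%N)); apply: fmax_le => x /=.
    have := ng j x; have := ng j.+1 x.
    have := fmax_ge x0 (iter j.+1 P g \- iter j P g) x.
    by rewrite addSn !ler_norml/=; lra.
have Pg x : P g x <= g x + c.
  by have := fmax_ge x0 (iter 1 P g \- iter 0 P g) x; rewrite growth /=; lra.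
exists c; split => //; apply: persistent_growth => // n.
have [x] := fmax_eq x0 (iter n.+1 P g \- iter n P g).
by rewrite growth => ->; exists x; rewrite /=; lra.
Qed.

(** Conjugation by negation turns minimal growth into maximal growth, so [cluster_max_growth] serves
    for both. *)
Definition dual_op P : (V -> R) -> V -> R := fun u => \- P (\- u).

Lemma iter_dual_op P n f : iter n (dual_op P) (\- f) = \- iter n P f.
Proof.
elim: n => //= n ->; rewrite /dual_op; congr (\- P _).
by apply/funext => x; rewrite /= opprK.
Qed.

Lemma dual_monotone P : monotone_op P -> monotone_op (dual_op P).
Proof.
move=> P_mono u v uv x; rewrite lerN2.
by apply: P_mono => y; rewrite lerN2.
Qed.

Lemma dual_strictly_monotone P :
  strictly_monotone_op P -> strictly_monotone_op (dual_op P).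
Proof.
move=> P_strict u v x uv uvx; rewrite ltrN2.
by apply: P_strict => [y|]; rewrite ?lerN2 ?ltrN2.
Qed.

Lemma dual_constant_additive P :
  constant_additive P -> constant_additive (dual_op P).
Proof.
move=> P_const u c; rewrite /dual_op.
have -> : \- (u \+ cst c) = (\- u) \+ cst (- c).
  by apply/funext => x; rewrite /= opprD.
by rewrite P_const; apply/funext => x; rewrite /= opprD opprK.
Qed.

Lemma dual_orbit_cluster P f g :
  orbit_cluster x0 P f g -> orbit_cluster x0 (dual_op P) (\- f) (\- g).
Proof.
move=> cl e e0 N; have [n Nn ng] := cl e e0 N; exists n => // x.
by rewrite iter_dual_op /normalized /= -!opprD normrN; exact: ng.
Qed.

Lemma cluster_eigen P f g (K : R) : monotone_op P -> strictly_monotone_op P ->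
  constant_additive P -> orbit_cluster x0 P f g ->
  (forall n x y, iter n P f x - iter n P f y <= K) ->
  exists c, P g = g \+ cst c.
Proof.
move=> P_mono P_strict P_const cl fK.
have [c [Pgc [x gx]]] := cluster_max_growth P_mono P_strict P_const cl.
have [c' [Pgc' [y gy]]] := cluster_max_growth (dual_monotone P_mono)
  (dual_strictly_monotone P_strict) (dual_constant_additive P_const)
  (dual_orbit_cluster cl).
(* Dually, [- c'] is a lower bound for [P g - g], so [c <= - c'] pinches it to [c]. *)
exists c; suff cc' : c + c' <= 0.
  apply/funext => z; apply/eqP; rewrite eq_le Pgc /=.
  have := Pgc' z; rewrite -[dual_op P _]/(iter 1 _ _) iter_dual_op /=; lra.
(* The gap between [iter n P g x] and [iter n P g y] grows at rate [c + c'], but stays within [K]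
   plus an error of 1 at each of the two points. *)
have bound n : (c + c') *+ n <= K + 2 - g x + g y.
  have [m _ [a mg]] := orbit_cluster_iter P_mono P_const cl ltr01 0%N.
  have := mg n x; have := mg n y; have := fK (n + m)%N x y.
  rewrite !ler_norml mulrnDl; have := gx n; have := gy n.
  by rewrite iter_dual_op /=; lra.
rewrite leNgt; apply/negP => cc'_gt0.
set M := K + 2 - g x + g y in bound.
have := archi_boundP (normr_ge0 (M / (c + c'))).
rewrite ltNge => /negP; apply; apply: le_trans (ler_norm _).
by rewrite ler_pdivlMr// mulr_natl.
Qed.

(** The orbit of [g] is [g] plus constants, so closeness at a single time [N], up to an offset,
    persists at all later times. *)
Lemma cluster_eigen_cvg P f g c : monotone_op P -> constant_additive P ->
  orbit_cluster x0 P f g -> P g = g \+ cst c ->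
  (forall x, (fun n => iter n P f x - iter n P f x0) @ \oo --> g x) /\
  (forall x, (fun n => iter n.+1 P f x - iter n P f x) @ \oo --> c).
Proof.
move=> P_mono P_const cl Pg.
have gx0 : g x0 = 0.
  apply/eqP; rewrite -normr_le0; apply/ler_addgt0Pl => e e0.
  have [n _ /(_ x0)] := cl e e0 0%N.
  by rewrite /normalized /= subrr sub0r normrN addr0 => /ltW.
have approx e : 0 < e -> exists N a, forall j x,
    `|iter (j + N) P f x - (g x + c *+ j) - a| <= e.
  move=> e0.
  have [N _ [a Na]] := orbit_cluster_iter P_mono P_const cl e0 0%N.
  by exists N, a => j x; rewrite -(iter_eigen P_const j Pg).
(* Half of [e] for each of two estimates whose difference removes [a]: at [x] and [x0] for the first
   limit, at consecutive times for the second. *)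
split=> x; apply/cvgrPdist_le => e e0;
  have [N [a Na]] := approx _ (divr_gt0 e0 (ltr0Sn R 1));
  exists N => // m /= /subnK mN.
- have := Na (m - N)%N x; have := Na (m - N)%N x0.
  by rewrite mN gx0 !ler_norml; lra.
- have := Na (m - N)%N x; have := Na (m - N).+1%N x.
  by rewrite addSn mN mulrSr !ler_norml/=; lra.
Qed.

End Cluster.

Theorem corollary1 (R : realType) (V : finType) (d : V -> V -> R)
    (P : (V -> R) -> (V -> R)) (r : R) (x0 : V)
    (dist_d : is_distance d)
    (P_mono : monotone_op P)
    (P_strict : strictly_monotone_op P)
    (P_const : constant_additive P)
    (r_gt0 : 0 < r)
    (Ric_ge0 : (0 <= Ric r P d)%E) :
  forall f : V -> R, Lip d f <= r ->
    exists g : V -> R,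
      {ptws, (fun n : nat => iter n P f \- cst (iter n P f x0)) @ \oo --> g} /\
      exists c : R,
        {ptws, (fun n : nat => iter n.+1 P f \- iter n P f) @ \oo --> cst c} /\
        P g = g \+ cst c.
Proof.
move=> f Lf.
have Lipn n : Lip d (iter n P f) <= r.
  by elim: n => // n; exact: Ric_ge0_Lip r_gt0 Ric_ge0.
(* A bound on all oscillations [r * d x y] at once, independent of [n]. *)
pose K := \sum_(p : V * V) r * d p.1 p.2.
have d_ge0 : forall x y, 0 <= d x y by case: dist_d.
have osc n x y : `|iter n P f x - iter n P f y| <= K.
  apply: (le_trans (Lip_le_dist x y dist_d (Lipn n))).
  rewrite /K (bigD1 (x, y))//= lerDl sumr_ge0// => p _.
  by rewrite mulr_ge0// ltW.
have [g cl] : exists g, orbit_cluster x0 P f g.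
  by apply: (@bounded_cluster _ _ _ K) => n x; exact: osc.
have [|c Pg] := cluster_eigen P_mono P_strict P_const cl (K := K).
  by move=> n x y; apply: le_trans (osc n x y); exact: ler_norm.
have [gcvg ccvg] := cluster_eigen_cvg P_mono P_const cl Pg.
by exists g; split; [|exists c; split => //]; exact/ptws_cvgP.
Qed.
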